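(* Let $\mathcal{G}$ be a finite connected graph with a chosen spanning tree $T$ and chosen orientations $e_1,\dots,e_r$ of the $r$ edges not in $T$, and let $l$ be a loop on $\mathcal{G}$. Write $\check N_i=\check N_i(l)=N_{e_i}(l)-N_{-e_i}(l)$, where $N_e(l)$ is the number of times $l$ traverses the oriented edge $e$. Then: a) $d(l)>1$ if and only if $\check N_i=0$ for all $1\le i\le r$. b) If $d(l)=1$, then $P_l=\sum_{1\le i\le r}\check N_i X_i$. c) If $d(l)\ge 1$, then $h_1(l)=\sum_{1\le i\le r}\check N_i\,h_1(\gamma_i)$ in $H_1$.
   Context: Graph: $\mathcal{G}$ is a finite connected non-oriented graph with vertex set $X$ and edge set $E$, with no loop edges and no multiple edges; $r=|E|-|X|+1$. The opposite of an oriented edge $e$ is denoted $-e$. A based loop is a path $(x_0,x_1,\dots,x_n,x_0)$ along edges; a loop is an equivalence class of based loops under cyclic shift. Fundamental group: with $T$ and $e_1,\dots,e_r$ fixed, the fundamental group of $\mathcal{G}$ (at any base point) is identified with the free group $\Gamma$ on generators $\gamma_1,\dots,\gamma_r$: a based loop that successively crosses the oriented non-tree edges $\varepsilon_1e_{i_1},\dots,\varepsilon_ke_{i_k}$ ($\varepsilon_a=\pm1$) has homotopy class $\gamma_{i_1}^{\varepsilon_1}\cdots\gamma_{i_k}^{\varepsilon_k}$. A loop $l$ therefore determines a conjugacy class of $\Gamma$ (equivalently, the unique geodesic, i.e. non-backtracking and tailless, loop $l^g$ homotopic to $l$). Lower central series: $\Gamma^{(1)}=\Gamma$, $\Gamma^{(n+1)}=[\Gamma^{(n)},\Gamma]$,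 $H_n=\Gamma^{(n)}/\Gamma^{(n+1)}$ (abelian, written additively), and $h_n:\Gamma^{(n)}\to H_n$ is the projection. The degree $d(l)$ is the largest $n$ such that the conjugacy class of $l$ is contained in $\Gamma^{(n)}$, with $d(l)=\infty$ if $l$ is homotopic to a point. If $d(l)\ge n$, $h_n(l)$ is the common value of $h_n$ on the conjugacy class of $l$. Signature: let $X_1,\dots,X_r$ be non-commuting symbols. For $g=\gamma_{j_1}^{n_1}\cdots\gamma_{j_m}^{n_m}\in\Gamma$, $S(g)=e^{n_1X_{j_1}}\cdots e^{n_mX_{j_m}}$ (a formal power series in the non-commuting $X_j$). $P_g$ is the sum of the terms of lowest degree of $S(g)-1$; it depends only on the conjugacy class of $g$, and $P_l$ denotes $P_g$ for any $g$ in the conjugacy class of $l$. *)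

(* Defs.v *)
From HB Require Import structures.
From mathcomp Require Import all_boot all_order all_algebra.
From mathcomp Require Import ring.
From mathcomp Require Import boolp classical_sets functions.

Set Implicit Arguments.
Unset Strict Implicit.
Unset Printing Implicit Defensive.

Import GRing.Theory Num.Theory.

Local Open Scope classical_set_scope.
Local Open Scope quotient_scope.

Record graph := Graph {
  vertex :> finType;
  adj : rel vertex;
  adj_sym : symmetric adj;
  adj_irr : irreflexive adj;
  adj_connected : forall x y, connect adj x y
}.

Section Graphs.
Variable G : graph.

Definition edges : {set {set G}} :=
  [set [set p.1; p.2] | p in [pred p : G * G | adj p.1 p.2]]%SET.

(* |E| - |X| + 1, written so that the truncated subtraction is harmless. *)
Definition nb_cotree : nat := #|edges| + 1 - #|G|.

(* The cycles of size at most 2 of a symmetric irreflexive relation are the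
   empty one and the back-and-forth traversals of an edge. *)
Definition acyclic (t : rel G) : Prop :=
  forall c : seq G, ucycle t c -> size c <= 2.

Definition spanning_tree (t : rel G) : Prop :=
  [/\ symmetric t, subrel t (@adj G), forall x y, connect t x y & acyclic t].

Definition oriented_cotree (t : rel G) (r : nat) (e : 'I_r -> G * G) : Prop :=
  (forall i, adj (e i).1 (e i).2 && ~~ t (e i).1 (e i).2) /\
  (forall x y, adj x y -> ~~ t x y ->
    exists! i, e i = (x, y) \/ e i = (y, x)).

(* The based loop (x_0, x_1, ..., x_n, x_0) is the pair of x_0 and
   [:: x_1; ...; x_n; x_0]; the constant path at x_0 is (x_0, [::]). *)
Definition is_based_loop (b : G * seq G) : bool :=
  path (@adj G) b.1 b.2 && (last b.1 b.2 == b.1).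

Record based_loop := BasedLoop {
  bl_val :> G * seq G;
  bl_valP : is_based_loop bl_val
}.
HB.instance Definition _ := [isSub for bl_val].
HB.instance Definition _ := [Choice of based_loop by <:].

Definition shift_of (k : nat) (b : G * seq G) : G * seq G :=
  (last b.1 (rot k b.2), rot k b.2).

Definition shift_equiv (b c : based_loop) : bool :=
  `[< exists k, bl_val c = shift_of k b >].

Lemma shift_equiv_refl : reflexive shift_equiv.
Proof.
move=> [[x p] /= H]; apply/asboolP; exists 0; rewrite /shift_of /= rot0.
by case/andP: (H) => _ /eqP /= ->.
Qed.

Lemma rot_ex (T : Type) (k : nat) (s : seq T) :
  exists2 k', k' <= size s & rot k s = rot k' s.
Proof. by exists (minn k (size s)); [exact: geq_minr | exact: rot_minn]. Qed.

Lemma last_rot (x : G) k (p : seq G) y : p != [::] ->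
  last x (rot k p) = last y (rot k p).
Proof.
move=> p0; have : rot k p != [::] by rewrite -size_eq0 size_rot size_eq0.
by case: (rot k p).
Qed.

Lemma shift_equiv_trans : transitive shift_equiv.
Proof.
move=> c b d /asboolP[k Hk] /asboolP[m Hm]; apply/asboolP.
rewrite {}Hm {}Hk /shift_of /=; set p := (bl_val b).2.
have [k' lek ->] := rot_ex k p.
have [m' lem ->] := rot_ex m (rot k' p); rewrite size_rot in lem.
exists (if m' + k' <= size p then m' + k' else m' + k' - size p).
rewrite rot_add_mod //; congr pair; set n := (if _ then _ else _).
have [->|p0] := eqVneq p [::]; first by [].
exact: last_rot.
Qed.

Lemma shift_equiv_sym : symmetric shift_equiv.
Proof.
suff H b c : shift_equiv b c -> shift_equiv c b by move=> b c; apply/idP/idP; apply: H.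
case: b => -[x p] /= Hb /asboolP[k Hk]; apply/asboolP; rewrite {}Hk /shift_of /=.
have [k' lek ->] := rot_ex k p.
exists (size p - k'); have -> : rot (size p - k') (rot k' p) = p.
  by rewrite -[in RHS](rotK k' p) /rotr size_rot.
case/andP: Hb => /= _ /eqP Hx; congr pair; rewrite -[LHS]Hx.
case: p Hx {lek} => [//|y p /= Hx].
by [].
Qed.

Canonical shift_equiv_equiv :=
  EquivRel shift_equiv shift_equiv_refl shift_equiv_sym shift_equiv_trans.

Definition loop : Type := {eq_quot shift_equiv}.
HB.instance Definition _ := Choice.on loop.
HB.instance Definition _ := Quotient.on loop.
HB.instance Definition _ := EqQuotient.on loop.

Definition traversed (b : G * seq G) : seq (G * G) := pairmap pair b.1 b.2.

Definition nb_cross (a : G * G) (l : loop) : nat :=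
  count_mem a (traversed (repr l)).

Definition opp_edge (a : G * G) : G * G := (a.2, a.1).

Definition net_cross (a : G * G) (l : loop) : int :=
  ((nb_cross a l)%:Z - (nb_cross (opp_edge a) l)%:Z)%R.

Lemma traversed_shift (b : based_loop) k :
  traversed (shift_of k b) = rot k (traversed b).
Proof.
case: b => -[x p] /= /andP[_ /= /eqP Hx]; rewrite /traversed /shift_of /=.
have [lekp|/ltnW ltpk] := leqP k (size p); last first.
  by rewrite !rot_oversize ?size_pairmap // Hx.
rewrite [X in _ = rot k (pairmap _ _ X)](_ : p = take k p ++ drop k p); last first.
  by rewrite cat_take_drop.
have Es : k = size (pairmap pair x (take k p)) by rewrite size_pairmap size_takel.
rewrite pairmap_cat [X in _ = rot X _]Es rot_size_cat /rot pairmap_cat !last_cat.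
move: Hx; rewrite -{1}(cat_take_drop k p) last_cat.
case: (take k p) => [|y p1] /=.
  by move=> ->.
by move=> ->.
Qed.

Lemma traversed_pi (b : based_loop) :
  exists k, traversed (repr (\pi_loop b)) = rot k (traversed b).
Proof.
have /eqmodP/asboolP[k Hk] : b = repr (\pi_loop b) %[mod loop] by rewrite reprK.
by exists k; rewrite Hk traversed_shift.
Qed.

Lemma nb_cross_pi a (b : based_loop) :
  nb_cross a (\pi_loop b) = count_mem a (traversed b).
Proof.
rewrite /nb_cross; have [k ->] := traversed_pi b.
by apply/permP; rewrite perm_rot.
Qed.

End Graphs.

Section FreeGroup.
Variable r : nat.

(* (i, true) stands for gamma_i and (i, false) for its inverse. *)
Definition letter : Type := ('I_r * bool)%type.
HB.instance Definition _ := Choice.on letter.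

Definition letter_inv (a : letter) : letter := (a.1, ~~ a.2).

Definition reduced (w : seq letter) : bool :=
  sorted (fun a b => b != letter_inv a) w.

Record free_group := FreeGroup {
  fg_word :> seq letter;
  fg_wordP : reduced fg_word
}.
HB.instance Definition _ := [isSub for fg_word].
HB.instance Definition _ := [Choice of free_group by <:].

Definition push (a : letter) (w : seq letter) : seq letter :=
  if w is b :: w' then if b == letter_inv a then w' else a :: w else [:: a].

Definition reduce (w : seq letter) : seq letter := foldr push [::] w.

Lemma letter_invK : involutive letter_inv.
Proof. by case=> i b; rewrite /letter_inv /= negbK. Qed.

Lemma reduced_push a w : reduced w -> reduced (push a w).
Proof.
case: w => [//|b w] /= Hw; case: ifPn => [_|nb]; first exact: path_sorted Hw.
by rewrite /reduced /= nb.
Qed.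

Lemma reduced_foldr s w : reduced s -> reduced (foldr push s w).
Proof. by move=> Hs; elim: w => //= a w IH; apply: reduced_push. Qed.

Lemma reduced_reduce w : reduced (reduce w).
Proof. exact: reduced_foldr. Qed.

Lemma reduce_id w : reduced w -> reduce w = w.
Proof.
elim: w => //= a w IH Hw; rewrite IH; last exact: path_sorted Hw.
by case: w Hw {IH} => //= b w /andP[/negbTE -> _].
Qed.

Lemma pushK a w : reduced w -> push (letter_inv a) (push a w) = w.
Proof.
case: w => [|b w] /= Hw; first by rewrite letter_invK eqxx.
case: (b =P letter_inv a) => [Eb|_] /=; last by rewrite letter_invK eqxx.
by case: w Hw => [|c w] /=; rewrite -Eb //; case/andP=> /negbTE ->.
Qed.

Lemma pushVK a w : reduced w -> push a (push (letter_inv a) w) = w.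
Proof. by move=> Hw; rewrite -{1}[a]letter_invK pushK. Qed.

Lemma foldr_reduce s w : reduced s -> foldr push s (reduce w) = foldr push s w.
Proof.
move=> Hs; elim: w => //= a w IH; rewrite -IH.
case: (reduce w) => [//|b w'] /=; case: eqP => [->|_] //=.
by rewrite pushVK // reduced_foldr.
Qed.

Definition fg_one : free_group := @FreeGroup [::] isT.

Definition fg_mul (u v : free_group) : free_group :=
  FreeGroup (reduced_reduce (fg_word u ++ fg_word v)).

Definition fg_inv (u : free_group) : free_group :=
  FreeGroup (reduced_reduce (rev (map letter_inv u))).

Lemma fg_word_inj : injective fg_word.
Proof. exact: val_inj. Qed.

Lemma fg_mulE u v : fg_word (fg_mul u v) = foldr push v u.
Proof. by rewrite /= /reduce foldr_cat -/(reduce v) reduce_id //; exact: fg_wordP. Qed.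

Lemma fg_mulA : associative fg_mul.
Proof.
move=> u v w; apply: fg_word_inj.
rewrite [LHS]fg_mulE [RHS]fg_mulE fg_mulE [fg_word (fg_mul u v)]/=.
by rewrite foldr_reduce ?foldr_cat //; exact: fg_wordP.
Qed.

Lemma fg_mul1 : left_id fg_one fg_mul.
Proof. by move=> u; apply: fg_word_inj => /=; rewrite reduce_id //; exact: fg_wordP. Qed.

Lemma fg_mulr1 : right_id fg_one fg_mul.
Proof. by move=> u; apply: fg_word_inj => /=; rewrite cats0 reduce_id //; exact: fg_wordP. Qed.

Lemma reduce_invl w : reduce (rev (map letter_inv w) ++ w) = [::].
Proof.
elim: w => //= a w IH; rewrite rev_cons cat_rcons /reduce foldr_cat /=.
by rewrite pushK ?reduced_foldr // -foldr_cat.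
Qed.

Lemma fg_mulV : left_inverse fg_one fg_inv fg_mul.
Proof.
move=> u; apply: fg_word_inj; rewrite [LHS]fg_mulE [fg_word (fg_inv u)]/=.
rewrite foldr_reduce; last exact: fg_wordP.
by rewrite -{1}(reduce_id (fg_wordP u)) -foldr_cat; exact: reduce_invl.
Qed.

Lemma fg_mulrV : right_inverse fg_one fg_inv fg_mul.
Proof.
move=> u; apply: fg_word_inj; rewrite [LHS]fg_mulE /= /reduce -foldr_cat.
rewrite -{1}(mapK letter_invK (fg_word u)) -{1}[map letter_inv u]revK map_rev.
exact: reduce_invl.
Qed.

HB.instance Definition _ :=
  isGroup.Build free_group fg_mulA fg_mul1 fg_mulr1 fg_mulV fg_mulrV.

Definition gamma (i : 'I_r) : free_group := @FreeGroup [:: (i, true)] isT.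

Definition letter_val (a : letter) : free_group :=
  if a.2 then gamma a.1 else (gamma a.1)^-1%g.

Lemma free_groupE (g : free_group) :
  g = (\prod_(a <- fg_word g) letter_val a)%g.
Proof.
case: g => w Hw /=; apply: fg_word_inj; rewrite /= -{1}(reduce_id Hw) {Hw}.
elim: w => [|a w IH]; first by rewrite big_nil.
by rewrite big_cons [LHS]/= IH; case: a => i []; symmetry; exact: fg_mulE.
Qed.

End FreeGroup.

Section LowerCentral.
Variable G : groupType.

Definition is_subgroup (A : set G) : Prop :=
  A 1%g /\ forall x y, A x -> A y -> A (x / y)%g.

Definition generated (A : set G) : set G := smallest is_subgroup A.

Definition commutators (A : set G) : set G :=
  [set [~ x, y]%g | x in A & y in [set: G]].

(* lcs n is Gamma^(n); the index starts at 1, and lcs 0 is lcs 1. *)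
Definition lcs (n : nat) : set G :=
  iter n.-1 (fun A => generated (commutators A)) setT.

Lemma generated_subgroup A : is_subgroup (generated A).
Proof.
split=> [B [[]] //|x y Ax Ay B BP]; case: (BP) => -[_ Bd] _.
by apply: Bd; [exact: Ax | exact: Ay].
Qed.

Lemma lcs_subgroup n : is_subgroup (lcs n).
Proof. by case: n => [|[|n]]; [split | split | exact: generated_subgroup]. Qed.

Lemma lcsS n x y : lcs n x -> lcs n.+1 [~ x, y]%g.
Proof.
case: n => [//|n] Ax; apply: sub_gen_smallest; exists x => //.
by exists y.
Qed.

Lemma lcs1 n : lcs n 1%g. Proof. by case: (lcs_subgroup n). Qed.
Lemma lcsF n x y : lcs n x -> lcs n y -> lcs n (x / y)%g.
Proof. by case: (lcs_subgroup n) => _; apply. Qed.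
Lemma lcsV n x : lcs n x -> lcs n (x^-1)%g.
Proof. by move=> Ax; rewrite -[(x^-1)%g]mul1g; apply: lcsF => //; apply: lcs1. Qed.
Lemma lcsM n x y : lcs n x -> lcs n y -> lcs n (x * y)%g.
Proof. by move=> Ax Ay; rewrite -[y]invgK; apply: lcsF => //; apply: lcsV. Qed.

Lemma lcsJ n x y : lcs n x -> lcs n (x ^ y)%g.
Proof.
elim: n x y => [//|[//|n] IH] x y.
move: x; apply: smallest_sub => [|_ [x Ax [z _ <-]]] /=.
  split=> [|a b Ha Hb] /=; first by rewrite conj1g; exact: lcs1.
  by rewrite conjMg conjVg; apply: lcsF.
by rewrite conjRg; apply/lcsS/IH.
Qed.

Lemma lcs_sub n x : lcs n.+1 x -> lcs n x.
Proof.
case: n x => [//|n]; apply: smallest_sub; first exact: lcs_subgroup.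
by move=> _ [x Ax [y _ <-]]; rewrite commgEl; apply: lcsM; [exact: lcsV|exact: lcsJ].
Qed.

Variable n : nat.

Record lcs_group := LcsGroup {
  lcs_val :> G;
  lcs_valP : lcs_val \in lcs n
}.
HB.instance Definition _ := [isSub for lcs_val].
HB.instance Definition _ := [Choice of lcs_group by <:].

Lemma lcs_group_closed : group_closed (fun x => x \in lcs n).
Proof.
split=> [|x y]; rewrite -!topredE /= !inE; first exact: lcs1.
exact: lcsF.
Qed.
HB.instance Definition _ :=
  SubChoice_isSubGroup.Build G (fun x => x \in lcs n) lcs_group lcs_group_closed.

Definition lcs_equiv (u v : lcs_group) : bool :=
  ((lcs_val u)^-1 * lcs_val v)%g \in lcs n.+1.

Lemma lcs_equiv_refl : reflexive lcs_equiv.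
Proof. by move=> u; rewrite /lcs_equiv mulVg inE; exact: lcs1. Qed.

Lemma lcs_equiv_sym : symmetric lcs_equiv.
Proof.
suff H u v : lcs_equiv u v -> lcs_equiv v u by move=> u v; apply/idP/idP; apply: H.
by rewrite /lcs_equiv !inE => /lcsV; rewrite invgM invgK.
Qed.

Lemma lcs_equiv_trans : transitive lcs_equiv.
Proof.
move=> v u w; rewrite /lcs_equiv !inE => uv vw.
by have := lcsM uv vw; rewrite mulgA mulgK.
Qed.

Canonical lcs_equiv_equiv :=
  EquivRel lcs_equiv lcs_equiv_refl lcs_equiv_sym lcs_equiv_trans.

Definition lcs_quot : Type := {eq_quot lcs_equiv}.
HB.instance Definition _ := Choice.on lcs_quot.
HB.instance Definition _ := Quotient.on lcs_quot.
HB.instance Definition _ := EqQuotient.on lcs_quot.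

Definition lcs_proj (u : lcs_group) : lcs_quot := \pi_lcs_quot u.

Definition lcs_quot_add (a b : lcs_quot) : lcs_quot := lcs_proj (repr a * repr b)%g.
Definition lcs_quot_opp (a : lcs_quot) : lcs_quot := lcs_proj ((repr a)^-1)%g.

Lemma lcs_projP u v :
  lcs_proj u = lcs_proj v <-> lcs n.+1 ((lcs_val u)^-1 * lcs_val v)%g.
Proof. by split=> [/eqmodP|H]; [|apply/eqmodP]; rewrite /= /lcs_equiv inE. Qed.

Lemma lcs_quotP (a : lcs_quot) : exists u, a = lcs_proj u.
Proof. by exists (repr a); rewrite /lcs_proj reprK. Qed.

Lemma lcs_projD u v : lcs_quot_add (lcs_proj u) (lcs_proj v) = lcs_proj (u * v)%g.
Proof.
rewrite /lcs_quot_add; set u' := repr _; set v' := repr _.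
have /lcs_projP Hu : lcs_proj u' = lcs_proj u by exact: reprK.
have /lcs_projP Hv : lcs_proj v' = lcs_proj v by exact: reprK.
apply/lcs_projP; have := lcsM (lcsJ (lcs_val v') Hu) Hv.
by rewrite /conjg /= !mulgA mulgK invgM.
Qed.

Lemma lcs_projN u : lcs_quot_opp (lcs_proj u) = lcs_proj (u^-1)%g.
Proof.
rewrite /lcs_quot_opp; set u' := repr _.
have /lcs_projP Hu : lcs_proj u' = lcs_proj u by exact: reprK.
apply/lcs_projP; have := lcsJ ((lcs_val u)^-1)%g (lcsV Hu).
by rewrite /conjg /= invgM !invgK !mulgA mulgV mul1g.
Qed.

Lemma lcs_quot_addA : associative lcs_quot_add.
Proof.
move=> a b c; have [u ->] := lcs_quotP a; have [v ->] := lcs_quotP b.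
by have [w ->] := lcs_quotP c; rewrite !lcs_projD mulgA.
Qed.

Lemma lcs_quot_addC : commutative lcs_quot_add.
Proof.
move=> a b; have [u ->] := lcs_quotP a; have [v ->] := lcs_quotP b.
rewrite !lcs_projD; apply/lcs_projP => /=.
have := @lcsS n (lcs_val v) (lcs_val u); rewrite /commg /conjg invgM -!mulgA; apply.
by have := lcs_valP v; rewrite inE.
Qed.

Lemma lcs_quot_add0 : left_id (lcs_proj 1%g) lcs_quot_add.
Proof. by move=> a; have [u ->] := lcs_quotP a; rewrite lcs_projD mul1g. Qed.

Lemma lcs_quot_addN : left_inverse (lcs_proj 1%g) lcs_quot_opp lcs_quot_add.
Proof.
by move=> a; have [u ->] := lcs_quotP a; rewrite lcs_projN lcs_projD mulVg.
Qed.

HB.instance Definition _ := GRing.isZmodule.Build lcs_quot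
  lcs_quot_addA lcs_quot_addC lcs_quot_add0 lcs_quot_addN.

(* h_n, extended by 0 outside Gamma^(n) so as to be a total function. *)
Definition lcs_class (g : G) : lcs_quot := lcs_proj (insubd (1%g : lcs_group) g).

Lemma lcs_classJ g x : lcs_class (g ^ x)%g = lcs_class g.
Proof.
rewrite /lcs_class /insubd.
case: insubP => [u _ Eu|]; case: insubP => [v _ Ev|] //=.
- apply/lcs_projP; rewrite Eu Ev /conjg invgM invgK.
  have := lcs_valP v; rewrite inE Ev => /(lcsS x)/lcsV.
  by rewrite /commg /conjg !invgM !invgK -!mulgA.
- case/negP; rewrite inE -[g](conjgK x).
  by apply: lcsJ; rewrite -Eu; have := lcs_valP u; rewrite inE.
- case/negP; rewrite inE; apply: lcsJ.
  by rewrite -Ev; have := lcs_valP v; rewrite inE.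
Qed.

End LowerCentral.

Section Signature.
Variable r : nat.
Local Open Scope ring_scope.

(* A formal power series in the non-commuting X_0, ..., X_(r-1) is given by its
   coefficients: f w is the coefficient of the monomial \prod_(i <- w) X_i. *)
Definition ncseries : Type := seq 'I_r -> rat.
HB.instance Definition _ := GRing.Zmodule.copy ncseries (seq 'I_r -> rat).

Definition ncs_one : ncseries := fun w => (w == [::])%:R.

Definition ncs_mul (f g : ncseries) : ncseries :=
  fun w => \sum_(k < (size w).+1) f (take k w) * g (drop k w).

Lemma ncs_mul_nil f g : ncs_mul f g [::] = f [::] * g [::].
Proof. by rewrite /ncs_mul big_ord_recl big_ord0 addr0. Qed.

Lemma ncs_mul_cons f g a w : ncs_mul f g (a :: w) =
  f [::] * g (a :: w) + ncs_mul (fun u => f (a :: u)) g w.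
Proof. by rewrite /ncs_mul /= big_ord_recl. Qed.

Lemma ncs_mulDl : left_distributive ncs_mul +%R.
Proof.
move=> f g h; apply/funext => w; rewrite /ncs_mul -[RHS]big_split /=.
by apply: eq_bigr => k _; rewrite -mulrDl.
Qed.

Lemma ncs_mulDr : right_distributive ncs_mul +%R.
Proof.
move=> f g h; apply/funext => w; rewrite /ncs_mul -[RHS]big_split /=.
by apply: eq_bigr => k _; rewrite -mulrDr.
Qed.

Lemma ncs_mulZl (c : rat) f g w :
  ncs_mul (fun u => c * f u) g w = c * ncs_mul f g w.
Proof. by rewrite /ncs_mul mulr_sumr; apply: eq_bigr => k _; rewrite mulrA. Qed.

Lemma ncs_mulA : associative ncs_mul.
Proof.
move=> f g h; apply/funext => w.
elim: w f g h => [|a w IH] f g h; first by rewrite !ncs_mul_nil mulrA.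
rewrite !ncs_mul_cons IH ncs_mul_nil.
have -> : (fun u => ncs_mul f g (a :: u)) =
    (fun u => f [::] * g (a :: u)) + ncs_mul (fun u => f (a :: u)) g :> ncseries.
  by apply/funext => u; rewrite ncs_mul_cons.
rewrite ncs_mulDl [X in _ = _ + X]/(_ + _) /= ncs_mulZl.
by rewrite mulrDr !addrA mulrA.
Qed.

Lemma ncs_mul1 : left_id ncs_one ncs_mul.
Proof.
move=> f; apply/funext => w; rewrite /ncs_mul big_ord_recl take0 drop0 mul1r.
rewrite big1 ?addr0 // => k _; rewrite /ncs_one.
by case: w k => [[]//|a w] k; rewrite mul0r.
Qed.

Lemma ncs_mulr1 : right_id ncs_one ncs_mul.
Proof.
move=> f; apply/funext => w; rewrite /ncs_mul big_ord_recr /= take_size drop_size mulr1.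
rewrite big1 ?add0r // => k _; rewrite /ncs_one -size_eq0 size_drop subn_eq0.
by rewrite leqNgt ltn_ord mulr0.
Qed.

Lemma ncs_one_neq0 : ncs_one != 0.
Proof. by apply/eqP => /(congr1 (@^~ [::]))/eqP; rewrite /ncs_one oner_eq0. Qed.

HB.instance Definition _ := GRing.Zmodule_isNzRing.Build ncseries
  ncs_mulA ncs_mul1 ncs_mulr1 ncs_mulDl ncs_mulDr ncs_one_neq0.

Definition ncX (i : 'I_r) : ncseries := fun w => (w == [:: i])%:R.

(* e^(q X_i): its coefficient at X_i^k is q^k / k`!. *)
Definition ncexp (q : rat) (i : 'I_r) : ncseries :=
  fun w => if all (pred1 i) w then q ^+ size w / (size w)`!%:R else 0.

(* S(g), applied to the expression of g as a product of gamma_i^(+-1) given by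
   its reduced word; see signatureM and signatureX for other expressions. *)
Definition signature (g : free_group r) : ncseries :=
  \prod_(a <- fg_word g) ncexp (if a.2 then 1 else -1) a.1.

(* At each word w, f w is kept exactly when f has no nonzero coefficient at a
   shorter word. *)
Definition lowest_part (f : ncseries) : ncseries :=
  fun w => if [forall k : 'I_(size w), forall u : k.-tuple 'I_r, f u == 0]
           then f w else 0.

Definition lowest_sig (g : free_group r) : ncseries :=
  lowest_part (signature g - 1).

Lemma ncexpD p q i : ncexp (p + q) i = ncexp p i * ncexp q i.
Proof.
apply/funext => w; rewrite -[RHS]/(ncs_mul _ _ w) /ncs_mul /ncexp.
case: ifPn => Hw; last first.
  rewrite big1 // => k _; move: Hw.
  rewrite -{1}(cat_take_drop k w) all_cat negb_and => /orP[] /negbTE ->.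
    by rewrite mul0r.
  by rewrite mulr0.
rewrite addrC exprDn mulr_suml; apply: eq_bigr => k _.
have lek : (k <= size w)%N by rewrite -ltnS.
move: Hw; rewrite -{1}(cat_take_drop k w) all_cat => /andP[-> ->].
rewrite size_takel // size_drop -(bin_fact lek) -mulr_natr !natrM.
have f0 m : (m`!%:R : rat) != 0 by rewrite pnatr_eq0 -lt0n fact_gt0.
have b0 : ('C(size w, k)%:R : rat) != 0 by rewrite pnatr_eq0 -lt0n bin_gt0.
by field; rewrite b0 !f0.
Qed.

Lemma ncexp0 i : ncexp 0 i = 1.
Proof.
apply/funext => -[|a w]; first by rewrite /ncexp /= expr0 fact0 divr1.
by rewrite /ncexp /= exprS !mul0r if_same.
Qed.

Lemma signature_push a w : \prod_(b <- push a w) ncexp (if b.2 then 1 else -1) b.1 =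
  ncexp (if a.2 then 1 else -1) a.1 * \prod_(b <- w) ncexp (if b.2 then 1 else -1) b.1.
Proof.
case: w => [|b w]; first by rewrite /= big_seq1 big_nil mulr1.
rewrite /=; case: eqP => [->|_]; last by rewrite big_cons.
rewrite big_cons mulrA -ncexpD /=.
by case: (a.2); rewrite /= ?subrr ?addNr ncexp0 mul1r.
Qed.

Lemma signature1 : signature 1%g = 1.
Proof. by rewrite /signature big_nil. Qed.

Lemma signatureM g h : signature (g * h)%g = signature g * signature h.
Proof.
rewrite /signature; have -> : fg_word (g * h)%g = foldr (@push r) h g by exact: fg_mulE.
elim: (fg_word g) => [|a w IH] /=; first by rewrite big_nil mul1r.
by rewrite signature_push IH big_cons mulrA.
Qed.

Lemma signatureX i n : signature (gamma i ^+ n)%g = ncexp n%:R i.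
Proof.
elim: n => [|n IH]; first by rewrite expg0 signature1 ncexp0.
rewrite expgS signatureM IH -nat1r ncexpD; congr (_ * _).
by rewrite /signature big_seq1.
Qed.

Lemma signatureXV i n : signature (gamma i ^- n)%g = ncexp (- n%:R) i.
Proof.
rewrite -[LHS]mulr1 -(ncexp0 i) -(subrr n%:R) ncexpD mulrA -signatureX -signatureM.
by rewrite mulVg signature1 mul1r.
Qed.

Lemma ncs_mul_low n (u f : ncseries) : u [::] = 1 ->
  (forall w, (size w < n)%N -> f w = 0) ->
  forall w, (size w <= n)%N -> (u * f) w = f w /\ (f * u) w = f w.
Proof.
move=> u1 f0 w lew; split.
  rewrite -[LHS]/(ncs_mul u f w) /ncs_mul big_ord_recl take0 drop0 u1 mul1r.
  rewrite big1 ?addr0 // => k _; rewrite f0 ?mulr0 // size_drop /=.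
  apply: leq_trans lew; rewrite /bump /= add1n ltn_subrL /=.
  by case: w k => [[]|].
rewrite -[LHS]/(ncs_mul f u w) /ncs_mul big_ord_recr /= take_size drop_size u1 mulr1.
rewrite big1 ?add0r // => k _; rewrite f0 ?mul0r //.
by rewrite size_takel ?(leq_trans (ltn_ord _)) // ltnW.
Qed.

Lemma lowest_partP (f g : ncseries) :
  (forall n, (forall w, (size w < n)%N -> f w = 0) ->
     forall w, (size w <= n)%N -> g w = f w) ->
  lowest_part g = lowest_part f.
Proof.
move=> fg; apply/funext => w; rewrite /lowest_part.
have lowP (h : ncseries) : reflect (forall u, (size u < size w)%N -> h u = 0)
    [forall k : 'I_(size w), forall u : k.-tuple 'I_r, h u == 0].
  apply: (iffP idP) => [/forallP H u lu|H].
    by have /forallP/(_ (in_tuple u))/eqP := H (Ordinal lu).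
  by apply/forallP => k; apply/forallP => u; rewrite H // size_tuple ltn_ord.
have [Hf|nf] := lowP f.
  rewrite (fg _ Hf) //; case: lowP => // -[] u lu.
  by rewrite (fg _ Hf) ?Hf // ltnW.
case: lowP => // Hg; case: nf => u.
elim: {u}(size u) {-2}u (leqnn (size u)) => [|n IH] u leu lu.
  by rewrite -(fg 0%N) // Hg.
by rewrite -(fg (size u)) ?Hg // => v lv; apply: IH; rewrite ?(ltn_trans lv) // -ltnS (leq_trans lv).
Qed.

Lemma signature_nil g : signature g [::] = 1.
Proof.
rewrite /signature; elim: (fg_word g) => [|a w IH]; first by rewrite big_nil.
rewrite big_cons -[LHS]/(ncs_mul _ _ [::]) ncs_mul_nil IH mulr1.
by rewrite /ncexp /= expr0 fact0 divr1.
Qed.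

Lemma lowest_sigJ g x : lowest_sig (g ^ x)%g = lowest_sig g.
Proof.
rewrite /lowest_sig; set f := signature g - 1.
have -> : signature (g ^ x)%g - 1 = signature x^-1%g * (f * signature x).
  rewrite /conjg !signatureM mulrBl mulrBr mul1r; congr (_ - _).
  by rewrite -signatureM mulVg signature1.
apply: lowest_partP => n f0 w lew.
have H := ncs_mul_low (signature_nil x) f0.
rewrite (proj1 (ncs_mul_low (n := n) (signature_nil _) _ lew)); first exact: (H _ _).2.
by move=> v lv; rewrite (H _ _).2 ?f0 // ltnW.
Qed.

End Signature.

Section LoopInvariants.
Variables (G : graph) (r : nat) (e : 'I_r -> G * G).

Definition edge_class (a : G * G) : free_group r :=
  if [pick i | e i == a] is Some i then gamma i
  else if [pick i | e i == opp_edge a] is Some i then (gamma i)^-1%g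
  else 1%g.

Definition homotopy_class (b : based_loop G) : free_group r :=
  (\prod_(a <- traversed b) edge_class a)%g.

Definition conj_class (l : loop G) : set (free_group r) :=
  [set g | exists b x, \pi_(loop G) b = l /\ g = (homotopy_class b ^ x)%g].

Definition homotopic_to_point (l : loop G) : Prop := conj_class l = [set 1%g].

Definition largest_lcs (l : loop G) : set nat :=
  [set n | conj_class l `<=` lcs n /\ forall m, conj_class l `<=` lcs m -> m <= n].

(* d(l), with None for infinity. The default value 0 is never taken, because
   free groups are residually nilpotent. *)
Definition degree (l : loop G) : option nat :=
  if `[< homotopic_to_point l >] then None else Some (xget 0 (largest_lcs l)).

Definition loop_class (n : nat) (l : loop G) : lcs_quot (free_group r) n :=
  lcs_class n (homotopy_class (repr l)).

Definition loop_lowest_sig (l : loop G) : ncseries r :=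
  lowest_sig (homotopy_class (repr l)).

Lemma homotopy_class_pi (b : based_loop G) :
  exists x, homotopy_class (repr (\pi_(loop G) b)) = (homotopy_class b ^ x)%g.
Proof.
rewrite /homotopy_class; have [k ->] := traversed_pi b.
exists (\prod_(a <- take k (traversed b)) edge_class a)%g.
rewrite /rot -[in RHS](cat_take_drop k (traversed b)) !big_cat /conjg /=.
rewrite cat_take_drop.
by rewrite !mulgA mulVg mul1g.
Qed.

Lemma conj_classP (l : loop G) g :
  conj_class l g -> exists x, g = (homotopy_class (repr l) ^ x)%g.
Proof.
case=> b [x [<- ->]]; have [y ->] := homotopy_class_pi b.
by exists (y^-1 * x)%g; rewrite conjgM conjgK.
Qed.

Lemma loop_class_conj n (l : loop G) g :
  conj_class l g -> lcs_class n g = loop_class n l.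
Proof. by case/conj_classP=> x ->; rewrite lcs_classJ. Qed.

Lemma loop_lowest_sig_conj (l : loop G) g :
  conj_class l g -> lowest_sig g = loop_lowest_sig l.
Proof. by case/conj_classP=> x ->; rewrite lowest_sigJ. Qed.

End LoopInvariants.

Definition enat_le (n : nat) (d : option nat) : bool :=
  if d is Some m then n <= m else true.
Definition enat_lt (n : nat) (d : option nat) : bool :=
  if d is Some m then n < m else true.

(* Main.v *)
Require Import Defs.
From mathcomp Require Import all_boot all_order all_algebra.
From mathcomp Require Import boolp classical_sets.

Set Implicit Arguments.
Unset Strict Implicit.
Unset Printing Implicit Defensive.

Import Order.TTheory GRing.Theory Num.Theory.

Local Open Scope ring_scope.

(** Let [g] be the homotopy class of [l].  Every additive function on the free
group takes at [g] the value [\sum_i phi (gamma i) *~ net_cross (e i) l]; applied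
to [h_1] and to the coefficients of the signature in degree one, this gives (c)
and the linear terms in (b), and both together show that [g] lies in [lcs 2] iff
all net crossings vanish.  To pass from this to the degree, one needs that
a nontrivial [g] is not in every [lcs n]: the signature of an element of [lcs n]
is [1] up to words of size at least [n], while the signature of a nontrivial
reduced word has a nonzero coefficient at the word of its syllables. *)

(** * Coefficients of the signature in degree at most one *)

Section Signature.
Variable r : nat.
Implicit Types (f u v : ncseries r) (g h : free_group r) (w : seq 'I_r) (i j : 'I_r).

Lemma ncsDE u v w : (u + v) w = u w + v w. Proof. by []. Qed.

Lemma ncsBE u v w : (u - v) w = u w - v w. Proof. by []. Qed.

Lemma ncsME u v w :
  (u * v) w = \sum_(k < (size w).+1) u (take k w) * v (drop k w).
Proof. by []. Qed.

Lemma ncsM_nil u v : (u * v) [::] = u [::] * v [::].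
Proof. exact: ncs_mul_nil. Qed.

Lemma ncsM_seq1 u v i :
  (u * v) [:: i] = u [::] * v [:: i] + u [:: i] * v [::].
Proof. by rewrite ncsME 2!big_ord_recl big_ord0 addr0. Qed.

Lemma ncs_sumE (I : finType) (F : I -> ncseries r) w :
  (\sum_i F i) w = \sum_i F i w.
Proof. by elim/big_rec2: _ => //= i _ y _ <-. Qed.

Lemma ncs_mulrzE u (n : int) w : (u *~ n) w = u w *~ n.
Proof.
have mulrnE m : (u *+ m) w = u w *+ m.
  by elim: m => // m IH; rewrite !mulrS ncsDE IH.
by case: n => m; rewrite ?NegzE ?mulrNz -?pmulrn -mulrnE.
Qed.

Lemma signature_seq1M g h i :
  signature (g * h)%g [:: i] = signature g [:: i] + signature h [:: i].
Proof.
by rewrite signatureM ncsM_seq1 !signature_nil mul1r mulr1 addrC.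
Qed.

Lemma signature_gamma_seq1 i j : signature (gamma i) [:: j] = (i == j)%:R.
Proof.
rewrite /signature big_seq1 /ncexp /= andbT eq_sym expr1 divr1.
by case: eqP.
Qed.

(** * Order of vanishing along the lower central series *)

Definition vanishes_below n f := forall w, (size w < n)%N -> f w = 0.

Lemma vanishes_below_mulr n u f :
  vanishes_below n f -> vanishes_below n (u * f).
Proof.
move=> f0 w wn; rewrite ncsME big1 // => k _; rewrite f0 ?mulr0 //.
by rewrite size_drop (leq_ltn_trans _ wn) // leq_subr.
Qed.

Lemma vanishes_below_mulD m n u v : vanishes_below m u -> vanishes_below n v ->
  vanishes_below (m + n) (u * v).
Proof.
move=> u0 v0 w wmn; rewrite ncsME big1 // => k _.
have [lt|ge] := ltnP (size (take k w)) m; first by rewrite u0 ?mul0r.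
rewrite v0 ?mulr0 //.
move: wmn; rewrite -{1}(cat_take_drop k w) size_cat => wmn.
by rewrite -(ltn_add2l m) (leq_ltn_trans _ wmn) // leq_add2r.
Qed.

Lemma vanishes_belowB n u v :
  vanishes_below n u -> vanishes_below n v -> vanishes_below n (u - v).
Proof. by move=> u0 v0 w wn; rewrite ncsBE u0 ?v0 ?subr0. Qed.

(** Ring commutators are unchanged when 1 is subtracted from both arguments, and [[~ g, h]] is
    [g^-1 * h^-1] times [g * h]. The form on the right shows factors whose vanishing orders add
    up. *)
Lemma signatureR g h :
  signature [~ g, h]%g - 1 = signature (g^-1 * h^-1)%g *
    ((signature g - 1) * (signature h - 1) - (signature h - 1) * (signature g - 1)).
Proof.
have -> : (signature g - 1) * (signature h - 1) -
    (signature h - 1) * (signature g - 1) = signature (g * h)%g - signature (h * g)%g.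
  have E u v : (u - 1) * (v - 1) = u * v - (u + v - 1).
    by rewrite mulrBl mul1r mulrBr mulr1 -addrA -opprD addrA.
  by rewrite !E !signatureM [signature h + _]addrC [- (_ * _ - _)]opprB addrA subrK.
rewrite mulrBr -!signatureM; congr (_ - _); last first.
  by rewrite -invgM mulVg signature1.
by congr signature; rewrite /commg /conjg !mulgA.
Qed.

(** The bound is stable under quotients, so it only has to be checked on commutators; these gain one
    order because [signature h - 1] has no constant term. *)
Lemma lcs_signature n g : lcs n g -> vanishes_below n (signature g - 1).
Proof.
elim: n g => [//|[_|n IH]] g.
  by move=> _ [|//] _; rewrite ncsBE signature_nil subrr.
move: g; apply: smallest_sub => [|_ [g gn [h _ <-]]] /=.
  split=> [|g h g1 h1]; first by rewrite signature1 subrr.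
  have -> : signature (g / h)%g - 1 = signature g * signature h^-1%g -
      signature h * signature h^-1%g.
    by rewrite -!signatureM mulgV signature1.
  have -> : signature g * signature h^-1%g - signature h * signature h^-1%g =
      ((signature g - 1) - (signature h - 1)) * signature h^-1%g.
    by rewrite opprB addrA subrK mulrBl.
  (* Vanishing below 0 is no condition on the right factor. *)
  rewrite -(addn0 n.+2); apply: vanishes_below_mulD => //.
  exact: vanishes_belowB.
rewrite signatureR; apply: vanishes_below_mulr.
have h0 : vanishes_below 1 (signature h - 1).
  by move=> [|//] _; rewrite ncsBE signature_nil subrr.
apply: vanishes_belowB; first by rewrite -addn1; apply: vanishes_below_mulD (IH _ gn) h0.
by rewrite -add1n; apply: vanishes_below_mulD h0 (IH _ gn).
Qed.

(** * Syllables and the faithfulness of the signature *)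

Definition stutter_free w := sorted (fun i j => i != j) w.

(* The indices of the syllables of a word, a syllable being a maximal block
   of equal generators. *)
Fixpoint syllables (s : seq (letter r)) : seq 'I_r :=
  if s is a :: s' then
    let w := syllables s' in if ohead w == Some a.1 then w else a.1 :: w
  else [::].

Definition letter_sgn (a : letter r) : rat := if a.2 then 1 else -1.

Definition word_signature (s : seq (letter r)) : ncseries r :=
  \prod_(a <- s) ncexp (letter_sgn a) a.1.

(* A stutter-free word starts with at most one [i], so only the terms of degree
   at most one of [ncexp q i] contribute. *)
Lemma ncexpM_stutter_free q i f j w : stutter_free (j :: w) ->
  (ncexp q i * f) (j :: w) = f (j :: w) + (if j == i then q * f w else 0).
Proof.
move=> jw; rewrite ncsME 2!big_ord_recl /= take0 drop0 addrA big1 ?addr0.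
  congr (_ + _); first by rewrite /ncexp /= expr0 divr1 mul1r.
  by rewrite /ncexp /= andbT; case: ifP; rewrite ?mul0r // expr1 divr1.
case: w jw => [|k w] /= => [_ []//|/andP[njk _]] m _.
rewrite /ncexp /=; case: ifP => [/and3P[/eqP Ej /eqP Ek _]|]; last by rewrite mul0r.
by rewrite Ej Ek eqxx in njk.
Qed.

Lemma stutter_free_syllables s : stutter_free (syllables s).
Proof.
elim: s => //= a s IH; case: ifP => // h.
case: (syllables s) IH h => //= i w iw; rewrite -[_ == _]/(i == a.1) => h.
by rewrite /stutter_free /= iw eq_sym h.
Qed.

(** Each letter either leaves the whole stutter-free word to the later letters or supplies just its
    first index. *)
Lemma word_signature_supp s w : stutter_free w -> word_signature s w != 0 ->
  subseq w (syllables s).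
Proof.
elim: s w => [|a s IH] w.
  by rewrite /word_signature big_nil; case: w => //= i w _; rewrite eqxx.
case: w => [|j w]; first by rewrite sub0seq.
move=> jw; rewrite /word_signature big_cons ncexpM_stutter_free //.
rewrite -/(word_signature s) => nz.
have sub_cons : subseq (syllables s) (syllables (a :: s)).
  by rewrite /=; case: ifP => // _; exact: subseq_cons.
have [s0|s0] := eqVneq (word_signature s (j :: w)) 0; last first.
  exact: subseq_trans (IH _ jw s0) sub_cons.
move: nz; rewrite s0 add0r; case: (j =P a.1) => [Ej|_]; last by rewrite eqxx.
rewrite mulf_eq0 negb_or => /andP[_ /(IH _ (path_sorted jw))] {s0}.
rewrite /= -Ej; case: (syllables s) => [|k v] /=; first by rewrite eqxx.
case: (eqVneq (Some k)) => [[->]|_] /=; last by rewrite eqxx.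
(* Here [a] joins the first syllable of [s]. As [w] follows [j] in a stutter-free word, it does not
   start with [j], so it embeds after that syllable. *)
rewrite eqxx; case: w jw => [_ _|m w] /=; first exact: sub0seq.
by case/andP=> /negbTE njm _; rewrite eq_sym njm.
Qed.

(** Here [k] is the length of the first syllable and [w] lists the later ones. In a reduced word the
    letters of a syllable have one sign, so exponents add up without cancelling and the coefficient
    at the syllable word is a product of nonzero exponents. *)
Lemma word_signature_syllables (a : letter r) s : reduced (a :: s) ->
  exists (w : seq 'I_r) (k : rat),
    [/\ syllables (a :: s) = a.1 :: w, word_signature (a :: s) w != 0, 0 < k &
        word_signature (a :: s) (a.1 :: w) =
        letter_sgn a * k * word_signature (a :: s) w].
Proof.
elim: s a => [|b s IH] a.
  move=> _; exists [::], 1; rewrite /word_signature big_seq1 /ncexp /= eqxx.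
  by rewrite !expr0 expr1 !divr1.
case/andP=> nba bs; have [w [k [Ew w0 k0 E]]] := IH b bs.
have bw : stutter_free (b.1 :: w) by rewrite -Ew stutter_free_syllables.
set s' := b :: s in Ew w0 E *.
have Ea w' : word_signature (a :: s') w' =
    (ncexp (letter_sgn a) a.1 * word_signature s') w'.
  by rewrite /word_signature big_cons.
have sk : word_signature s' (b.1 :: w) != 0.
  rewrite E !mulf_neq0 //; last by rewrite gt_eqF.
  by rewrite /letter_sgn; case: ifP; rewrite ?oppr_eq0 oner_eq0.
have -> : syllables (a :: s') =
    if Some b.1 == Some a.1 then b.1 :: w else [:: a.1, b.1 & w].
  by rewrite -Ew -[Some b.1]/(ohead (b.1 :: w)) -Ew.
case: (eqVneq (Some b.1)) => [[Eba]|nE].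
  (* Neighbours with the same index are equal or inverse, and reducedness excludes the latter. *)
  have Eab : b = a.
    case: a b Eba nba {IH bs bw s' Ew w0 E Ea sk} => [i x] [j y] /= ->.
    by rewrite /letter_inv xpair_eqE eqxx /=; case: x; case: y.
  rewrite -Eab in Ea *; exists w, (k + 1).
  (* The tail [w] does not start with [b.1], so the extra letter leaves its coefficient alone. *)
  have Es' : word_signature (b :: s') w = word_signature s' w.
    rewrite Ea; case: (w) bw => [|j w'] /=.
      by rewrite ncsM_nil /ncexp /= expr0 divr1 mul1r.
    rewrite /stutter_free /= => /andP[nbj jv].
    by rewrite ncexpM_stutter_free // eq_sym (negbTE nbj) addr0.
  split=> //; first by rewrite Es'.
    by rewrite addr_gt0.
  by rewrite Es' Ea ncexpM_stutter_free // eqxx E mulrDr mulr1 mulrDl.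
have nab : b.1 != a.1 by apply: contraNneq nE => ->.
exists (b.1 :: w), 1; split=> //.
  by rewrite Ea ncexpM_stutter_free // (negbTE nab) addr0.
have abw : stutter_free [:: a.1, b.1 & w] by rewrite /stutter_free /= eq_sym nab.
rewrite !Ea !ncexpM_stutter_free // eqxx (negbTE nab) addr0 mulr1.
(* This word is longer than the syllable word of [s'], hence outside the support. *)
suff -> : word_signature s' [:: a.1, b.1 & w] = 0 by rewrite add0r.
apply/eqP; apply: contraT => /(word_signature_supp abw).
by rewrite Ew => /size_subseq; rewrite ltnn.
Qed.

(** For a nonempty word, the nonzero coefficient at [w] would force [w] to be empty, and then the
    coefficient at a word of size one would be nonzero too. *)
Lemma signature_eq1 g : signature g = 1 -> g = 1%g.
Proof.
case: g => [[|a s] gP] E; first exact: fg_word_inj.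
have [w [k [_ w0 k0 Ew]]] := word_signature_syllables gP.
have {}E : word_signature (a :: s) = 1 := E.
move: Ew w0; rewrite E; case: w => [|i w]; last by rewrite eqxx.
rewrite /= -[LHS]/(0 : rat) => /esym/eqP; rewrite !mulf_eq0 (gt_eqF k0) orbF.
by rewrite /letter_sgn; case: (a.2); rewrite ?oppr_eq0 oner_eq0.
Qed.

Lemma lcs_trivial g : (forall n, lcs n g) -> g = 1%g.
Proof.
move=> gn; apply: signature_eq1; apply/funext => w.
by apply/eqP; rewrite -subr_eq0 -ncsBE (lcs_signature (gn (size w).+1)).
Qed.

End Signature.

(** * The lower central series and its first quotient *)

Lemma lcs_mono (G : groupType) m n (x : G) : (m <= n)%N -> lcs n x -> lcs m x.
Proof.
move/subnK<-; elim: (n - m)%N => // k IH.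
by rewrite addSn => /lcs_sub.
Qed.

Section FirstHomology.
Variable G : groupType.

Lemma lcs1_mem (x : G) : x \in lcs 1.
Proof. by rewrite inE. Qed.

Lemma lcs_class1E (x : G) : lcs_class 1 x = lcs_proj (LcsGroup (lcs1_mem x)).
Proof.
rewrite /lcs_class; congr lcs_proj; apply: val_inj.
by rewrite val_insubd lcs1_mem.
Qed.

Lemma lcs_class1M (x y : G) :
  lcs_class 1 (x * y)%g = lcs_class 1 x + lcs_class 1 y.
Proof.
rewrite !lcs_class1E -[RHS]/(lcs_quot_add _ _) lcs_projD; congr lcs_proj.
exact: val_inj.
Qed.

Lemma lcs_class1_eq0 (x : G) : lcs_class 1 x = 0 -> lcs 2 x.
Proof.
rewrite lcs_class1E -[0]/(lcs_proj 1%g) => /lcs_projP /= /lcsV.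
by rewrite invgM invgK invg1 mul1g.
Qed.

End FirstHomology.

(** * Additive invariants and net crossings *)

Section Loops.
Variables (G : graph) (t : rel G) (r : nat) (e : 'I_r -> G * G).
Hypothesis he : oriented_cotree t e.
Implicit Types (l : loop G) (i j : 'I_r).

Lemma cotree_uniq i j : e j = e i \/ e j = opp_edge (e i) -> j = i.
Proof.
case: he => he1 he2 ji; have /andP[adji nti] := he1 i.
have [k [_ uk]] := he2 _ _ adji nti.
rewrite -(uk i); last by left; case: (e i).
by rewrite -(uk j) //; case: ji => ->; [left; case: (e i) | right].
Qed.

Lemma cotree_inj : injective e.
Proof. by move=> i j Eij; apply: cotree_uniq; left. Qed.

(** Otherwise uniqueness gives [i = j], and [e j] would be a loop edge. *)
Lemma cotree_opp_neq i j : (e i == opp_edge (e j)) = false.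
Proof.
apply/eqP => Eij; have Ej : i = j by apply: cotree_uniq; right.
have /andP[] := he.1 j; move: Eij; rewrite Ej; case: (e j) => x y [-> _] /=.
by rewrite adj_irr.
Qed.

Lemma opp_edgeK : involutive (@opp_edge G). Proof. by case. Qed.

Section Additive.
Variables (V : zmodType) (phi : free_group r -> V).
Hypothesis phiM : forall g h, phi (g * h)%g = phi g + phi h.

Lemma additive1 : phi 1%g = 0.
Proof. by apply: (addrI (phi 1%g)); rewrite -phiM mulg1 addr0. Qed.

Lemma additiveV g : phi g^-1%g = - phi g.
Proof. by apply/eqP; rewrite -addr_eq0 -phiM mulVg additive1. Qed.

(** At most one index and one orientation match [a], so the sum has at most one nonzero term. *)
Lemma additive_edge_class a : phi (edge_class e a) =
  \sum_i phi (gamma i) *~ ((e i == a)%:Z - (opp_edge (e i) == a)%:Z).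
Proof.
rewrite /edge_class; case: pickP => [j /eqP <-|na].
  rewrite (bigD1 j) //= eqxx eq_sym cotree_opp_neq subr0 big1 ?addr0 // => i nij.
  by rewrite (inj_eq cotree_inj) (negbTE nij) eq_sym cotree_opp_neq.
case: pickP => [j /eqP Ej|no].
  have -> : a = opp_edge (e j) by rewrite Ej opp_edgeK.
  rewrite (bigD1 j) //= eqxx cotree_opp_neq sub0r mulrNz additiveV.
  rewrite big1 ?addr0 // => i nij; rewrite cotree_opp_neq.
  by rewrite (can_eq opp_edgeK) (inj_eq cotree_inj) (negbTE nij).
rewrite additive1 big1 // => i _; rewrite na.
by rewrite -(can_eq opp_edgeK) opp_edgeK no.
Qed.

Lemma additive_homotopy_class l : phi (homotopy_class e (repr l)) =
  \sum_i phi (gamma i) *~ net_cross (e i) l.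
Proof.
rewrite /homotopy_class /net_cross /nb_cross; elim: (traversed _) => [|a s IH].
  by rewrite big_nil additive1 big1.
rewrite big_cons phiM IH additive_edge_class -big_split; apply: eq_bigr => i _ /=.
rewrite -mulrzDr !PoszD opprD addrACA.
by rewrite (eq_sym a (e i)) (eq_sym a (opp_edge _)).
Qed.

End Additive.

Lemma loop_class1E l :
  loop_class e 1 l = \sum_i lcs_class 1 (gamma i) *~ net_cross (e i) l.
Proof. exact: additive_homotopy_class (@lcs_class1M _) l. Qed.

Lemma signature_homotopy_class_seq1 l i :
  signature (homotopy_class e (repr l)) [:: i] = (net_cross (e i) l)%:~R.
Proof.
rewrite (additive_homotopy_class (fun g h => signature_seq1M g h i)).
rewrite (bigD1 i) //= signature_gamma_seq1 eqxx big1 ?addr0 // => j nij.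
by rewrite signature_gamma_seq1 (negbTE nij) mul0rz.
Qed.

Lemma lcs2_net_cross l : lcs 2 (homotopy_class e (repr l)) <->
  forall i, net_cross (e i) l = 0.
Proof.
split=> [l2 i|net0]; last first.
  apply: lcs_class1_eq0; rewrite -[LHS]/(loop_class e 1 l) loop_class1E.
  by rewrite big1 // => i _; rewrite net0 mulr0z.
apply/eqP; rewrite -(intr_eq0 rat) -signature_homotopy_class_seq1.
by have := lcs_signature l2 (w := [:: i]) isT; rewrite ncsBE subr0 => ->.
Qed.

(** * Conjugacy class and degree of a loop *)

Lemma conj_class_repr l : conj_class e l (homotopy_class e (repr l)).
Proof. by exists (repr l), 1%g; rewrite reprK conjg1. Qed.

Lemma conj_class_sub_lcs n l :
  (conj_class e l `<=` lcs n)%classic <-> lcs n (homotopy_class e (repr l)).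
Proof.
split=> [|ln g /conj_classP[x ->]]; last exact: lcsJ.
by apply; exact: conj_class_repr.
Qed.

Lemma homotopic_to_pointP l :
  homotopic_to_point e l <-> homotopy_class e (repr l) = 1%g.
Proof.
split=> [E|E]; first by have := conj_class_repr l; rewrite [conj_class _ _]E.
apply/seteqP; split=> [g /conj_classP[x ->]|_ ->] /=; first by rewrite E conj1g.
by rewrite -E; exact: conj_class_repr.
Qed.

Lemma largest_lcs_nonempty l : homotopy_class e (repr l) <> 1%g ->
  exists n, largest_lcs e l n.
Proof.
move=> g1; have [n gn] : exists n, ~ lcs n (homotopy_class e (repr l)).
  by apply/existsNP => /lcs_trivial.
pose P n := `[< lcs n (homotopy_class e (repr l)) >].
(* [lcs 0] is the whole group. *)
have P0 : exists n, P n by exists 0%N; apply/asboolP.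
have Pn m : P m -> (m <= n)%N.
  move/asboolP => lm; rewrite leqNgt; apply/negP => /ltnW nm.
  exact: gn (lcs_mono nm lm).
case: (ex_maxnP P0 Pn) => m /asboolP Pm mmax; exists m; split.
  exact/conj_class_sub_lcs.
by move=> k /conj_class_sub_lcs lk; apply: mmax; apply/asboolP.
Qed.

Lemma degree_gt1 l : enat_lt 1 (degree e l) <-> lcs 2 (homotopy_class e (repr l)).
Proof.
rewrite /degree; case: asboolP => [/homotopic_to_pointP ->|].
  by split=> // _; exact: lcs1.
move=> nl; have [n nP] : exists n, largest_lcs e l n.
  by apply: largest_lcs_nonempty => /homotopic_to_pointP.
(* The witness [n] rules out the default value of [xget]. *)
case: xgetP => [m -> [/conj_class_sub_lcs lm mmax]|/(_ n)//].
split=> [m1|l2]; first exact: lcs_mono m1 lm.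
exact/mmax/conj_class_sub_lcs.
Qed.

Lemma sum_ncX_coef (c : 'I_r -> int) (w : seq 'I_r) :
  (\sum_i ncX i *~ c i) w = if w is [:: i] then (c i)%:~R else 0.
Proof.
rewrite ncs_sumE; under eq_bigr do rewrite ncs_mulrzE /ncX.
case: w => [|i [|j w]]; try by rewrite big1 // => k _; rewrite ?eqseq_cons ?andbF mul0rz.
rewrite (bigD1 i) //= eqxx big1 ?addr0 // => k nki.
by rewrite eqseq_cons andbT eq_sym (negbTE nki) mul0rz.
Qed.

(** Subtracting 1 kills the constant term, so degree one is kept; the nonzero coefficient at
    [[:: i]] discards every longer word. *)
Lemma loop_lowest_sigE l i : net_cross (e i) l != 0 ->
  loop_lowest_sig e l = \sum_i ncX i *~ net_cross (e i) l.
Proof.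
move=> ni; apply/funext => w; rewrite sum_ncX_coef.
rewrite /loop_lowest_sig /lowest_sig /lowest_part.
case: w => [|j [|k w]].
- by rewrite ncsBE signature_nil subrr if_same.
- rewrite ncsBE signature_homotopy_class_seq1 subr0.
  case: ifP => // /negP[]; apply/forallP => -[[|//] lt0]; apply/forallP => u.
  by rewrite tuple0 ncsBE signature_nil subrr.
- case: ifP => // /forallP/(_ (Ordinal (isT : (1 < (size w).+2)%N))).
  move/forallP/(_ [tuple i]); rewrite ncsBE signature_homotopy_class_seq1 subr0.
  by rewrite intr_eq0 (negbTE ni).
Qed.

End Loops.

Theorem proposition1 (G : graph) (t : rel G) (ht : spanning_tree t)
    (e : 'I_(nb_cotree G) -> G * G) (he : oriented_cotree t e) (l : loop G) :
  [/\ enat_lt 1 (degree e l) <-> (forall i, net_cross (e i) l = 0),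
      degree e l = Some 1%N ->
        loop_lowest_sig e l = \sum_i ncX i *~ net_cross (e i) l
    & enat_le 1 (degree e l) ->
        loop_class e 1 l = \sum_i lcs_class 1 (gamma i) *~ net_cross (e i) l].
Proof.
have a_iff := iff_trans (degree_gt1 e l) (lcs2_net_cross he l).
split=> // [d1|_]; last exact: loop_class1E he l.
(* By (a), degree one prevents all net crossings from vanishing. *)
have [i /eqP ni] : exists i, net_cross (e i) l <> 0.
  by apply/existsNP => /a_iff; rewrite d1.
exact: (loop_lowest_sigE he ni).
Qed.
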